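(* Let $(L_n)_{n\ge 0}$ be the Lucas sequence. For a natural number $N$, call a finite set $I\subseteq\{0,1,2,\ldots\}$ a non-consecutive partition of $N$ if no two elements of $I$ are consecutive integers and $\sum_{i\in I}L_i=N$ (here $L_0$ and $L_2$ are allowed to appear simultaneously, i.e. $I$ may contain both $0$ and $2$). Then every natural number has at most two distinct non-consecutive partitions.
   Context: The Lucas sequence is defined by $L_0=2$, $L_1=1$, and $L_n=L_{n-1}+L_{n-2}$ for $n\ge 2$. *)

(* Defs.v *)
From mathcomp Require Import all_boot finmap.

Set Implicit Arguments.
Unset Strict Implicit.
Unset Printing Implicit Defensive.

Fixpoint lucas (n : nat) : nat :=
  match n with
  | 0 => 2
  | 1 => 1
  | (m.+1 as k).+1 => lucas k + lucas m
  end.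

(* Indices 0 and 2 may both belong to I: no condition beyond non-consecutivity. *)
Definition nonconsecutive_partition (N : nat) (I : {fset nat}) : Prop :=
  (forall i j : nat, i \in I -> j \in I -> j <> i.+1) /\
  \sum_(i <- I) lucas i = N.

(* Main.v *)
(** The relation L_0 + L_2 = L_1 + L_3 is the source of non-uniqueness: among
    non-consecutive sets that do not contain both 0 and 2 the sum determines the
    set, by the greedy bound that such a set with all elements below n has sum
    less than L_n (for n <> 1).  A set that contains both 0 and 2 becomes one of
    the first kind, with sum N - 2, when 0 is removed.  So there is at most one
    partition of each kind. *)
Require Import Defs.
From mathcomp Require Import all_boot finmap.

Local Open Scope fset_scope.
Local Open Scope nat_scope.

Definition nonconsecutive (I : {fset nat}) : Prop :=
  forall i j : nat, i \in I -> j \in I -> j <> i.+1.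

Definition admissible (I : {fset nat}) : Prop :=
  nonconsecutive I /\ ~~ ((0 \in I) && (2 \in I)).

Definition bounded (n : nat) (I : {fset nat}) : Prop :=
  forall i, i \in I -> i < n.

Lemma nonconsecutive_sub (I J : {fset nat}) :
  J `<=` I -> nonconsecutive I -> nonconsecutive J.
Proof. by move=> /fsubsetP JI ncI i j /JI iI /JI; apply: ncI. Qed.

Lemma admissible_sub (I J : {fset nat}) :
  J `<=` I -> admissible I -> admissible J.
Proof.
move=> sJI [ncI n02]; split; first exact: nonconsecutive_sub ncI.
by apply: contra n02 => /andP[J0 J2]; rewrite !(fsubsetP sJI).
Qed.

Lemma sum_lucasD1 (I : {fset nat}) n : n \in I ->
  \sum_(i <- I) lucas i = lucas n + \sum_(i <- I `\ n) lucas i.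
Proof. exact: big_fsetD1. Qed.

Lemma bounded0 (I : {fset nat}) : bounded 0 I -> I = fset0.
Proof. by move=> bI; apply/fsetP => i; rewrite in_fset0; apply/negP => /bI. Qed.

Lemma bounded_notin n (I : {fset nat}) :
  bounded n.+1 I -> n \notin I -> bounded n I.
Proof.
move=> bI nI i iI; have := bI i iI; rewrite ltnS leq_eqVlt => /orP[/eqP ein|//].
by rewrite -ein iI in nI.
Qed.

Lemma bounded_D1 n (I : {fset nat}) : bounded n.+1 I -> bounded n (I `\ n).
Proof.
move=> bI; apply: bounded_notin; last by rewrite !inE eqxx.
by move=> i /fsetD1P[_ /bI].
Qed.

Lemma bounded_D1_pred n (I : {fset nat}) : nonconsecutive I ->
  bounded n.+2 I -> n.+1 \in I -> bounded n (I `\ n.+1).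
Proof.
move=> ncI bI nI; apply: bounded_notin; first exact: bounded_D1.
by apply/negP => /fsetD1P[_ /ncI/(_ nI)].
Qed.

(* The bound is L_n except at n = 1, where the set {0} has sum 2 > L_1. *)
Definition sum_bound (n : nat) : nat := if n == 1 then 3 else lucas n.

(** The exceptional value 3 at [n = 1] is what makes this hold: [lucas] itself drops from 2 to 1
    there. *)
Lemma leq_sum_bound n : sum_bound n <= sum_bound n.+1.
Proof. by case: n => [|[|n]] //; rewrite /sum_bound /= leq_addr. Qed.

(** Strong induction is used because a top index [n] excludes [n.-1], so the other elements lie
    below [n.-1]; adding [lucas n] to their bound gives the next Lucas number. *)
Lemma sum_lucas_lt n (I : {fset nat}) :
  admissible I -> bounded n I -> \sum_(i <- I) lucas i < sum_bound n.
Proof.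
elim/ltn_ind: n I => -[|n] IHn I aI bI.
  by rewrite (bounded0 _ bI) big_seq_fset0.
have [nI|nI] := boolP (n \in I); last first.
  apply: leq_trans (leq_sum_bound n); apply: IHn => //.
  exact: bounded_notin.
have aD : admissible (I `\ n) by apply: admissible_sub aI; apply: fsubD1set.
rewrite (sum_lucasD1 _ _ nI).
case: n => [|n] in IHn bI nI aD *.
  by rewrite (bounded0 _ (bounded_D1 _ _ bI)) big_seq_fset0.
have bD := bounded_D1_pred _ _ aI.1 bI nI.
case: n => [|[|n]] in IHn bI nI aD bD *.
- by rewrite (bounded0 _ bD) big_seq_fset0.
(* With top index 2 the rest lies in {0}, where the exceptional bound 3 is too weak. Admissibility
   excludes 0, and with it the sum 2 + 3 = 5, which exceeds L_3 = 4. *)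
- have bD0 : bounded 0 (I `\ 2).
    apply: bounded_notin bD _; apply: contra aI.2 => /fsetD1P[_ ->].
    by rewrite nI.
  by rewrite (bounded0 _ bD0) big_seq_fset0.
- have /= := IHn n.+2 (leqnSn _) _ aD bD.
  by rewrite /sum_bound /= ltn_add2l.
Qed.

(** The left sum is at least [lucas n], while the greedy bound keeps the right one below it, except
    at [n = 1]. *)
Lemma sum_lucas_neq n (I J : {fset nat}) : admissible I -> admissible J ->
    bounded n.+1 I -> bounded n J -> n \in I ->
  \sum_(i <- I) lucas i <> \sum_(i <- J) lucas i.
Proof.
move=> aI aJ bI bJ nI eIJ.
have := sum_lucas_lt _ _ aJ bJ; rewrite -eIJ (sum_lucasD1 _ _ nI) /sum_bound.
case: eqP => [n1 _|_]; last by rewrite ltnNge leq_addr.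
(* For [n = 1], [I] is {1} with sum 1, whereas [J] is empty or {0}, with sum 0 or 2. *)
rewrite {n}n1 in bI bJ nI.
move: eIJ; rewrite (sum_lucasD1 _ _ nI).
rewrite (bounded0 _ (bounded_D1_pred _ _ aI.1 bI nI)) big_seq_fset0.
have [J0|J0] := boolP (0 \in J).
  by rewrite (sum_lucasD1 _ _ J0).
by rewrite (bounded0 _ (bounded_notin _ _ bJ J0)) big_seq_fset0.
Qed.

(** The sum decides whether the top index occurs: if it lies in both sets it cancels, and it cannot
    lie in just one by [sum_lucas_neq]. *)
Lemma admissible_inj_bounded n (I J : {fset nat}) :
    admissible I -> admissible J -> bounded n I -> bounded n J ->
  \sum_(i <- I) lucas i = \sum_(i <- J) lucas i -> I = J.
Proof.
elim: n I J => [|n IHn] I J aI aJ bI bJ eIJ.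
  by rewrite (bounded0 _ bI) (bounded0 _ bJ).
have [nI|nI] := boolP (n \in I); have [nJ|nJ] := boolP (n \in J).
- rewrite -(fsetD1K nI) -(fsetD1K nJ); congr (_ |` _); apply: IHn.
  + by apply: admissible_sub aI; apply: fsubD1set.
  + by apply: admissible_sub aJ; apply: fsubD1set.
  + exact: bounded_D1.
  + exact: bounded_D1.
  + by move: eIJ; rewrite (sum_lucasD1 _ _ nI) (sum_lucasD1 _ _ nJ) => /addnI.
- by case: (sum_lucas_neq n I J) => //; apply: bounded_notin.
- by case: (sum_lucas_neq n J I) => //; apply: bounded_notin.
- by apply: IHn => //; apply: bounded_notin.
Qed.

Lemma fset_bounded (I J : {fset nat}) : exists n, bounded n I /\ bounded n J.
Proof.
exists (\max_(i <- I `|` J) i).+1.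
by split=> i iIJ; rewrite ltnS; apply: leq_bigmax_seq; rewrite ?inE ?iIJ ?orbT.
Qed.

Lemma admissible_inj (I J : {fset nat}) : admissible I -> admissible J ->
  \sum_(i <- I) lucas i = \sum_(i <- J) lucas i -> I = J.
Proof.
move=> aI aJ; have [n [bI bJ]] := fset_bounded I J.
exact: admissible_inj_bounded bI bJ.
Qed.

Lemma admissible_D1_0 (I : {fset nat}) :
  nonconsecutive I -> admissible (I `\ 0).
Proof.
move=> ncI; split; last by rewrite !inE.
by apply: nonconsecutive_sub ncI; apply: fsubD1set.
Qed.

Lemma nonconsecutive_partition_inj N (I J : {fset nat}) :
    nonconsecutive_partition N I -> nonconsecutive_partition N J ->
    (0 \in I) && (2 \in I) = (0 \in J) && (2 \in J) ->
  I = J.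
Proof.
move=> [ncI sI] [ncJ sJ] e02; have eIJ := etrans sI (esym sJ).
have [I02|I02] := boolP ((0 \in I) && (2 \in I)); last first.
  by apply: admissible_inj eIJ; split; rewrite -?e02.
have [/andP[I0 _]] := I02; have /andP[J0 _] : (0 \in J) && (2 \in J) by rewrite -e02.
(* Both sets contain 0 and 2, so dropping 0 lowers both sums by [lucas 0] and leaves admissible
   sets. *)
rewrite -(fsetD1K I0) -(fsetD1K J0); congr (_ |` _).
apply: admissible_inj; [exact: admissible_D1_0 | exact: admissible_D1_0 |].
by move: eIJ; rewrite (sum_lucasD1 _ _ I0) (sum_lucasD1 _ _ J0) => /addnI.
Qed.

Theorem theorem1p3 (N : nat) (I1 I2 I3 : {fset nat}) :
  nonconsecutive_partition N I1 ->
  nonconsecutive_partition N I2 ->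
  nonconsecutive_partition N I3 ->
  I1 = I2 \/ I1 = I3 \/ I2 = I3.
Proof.
move=> p1 p2 p3.
have inj12 := nonconsecutive_partition_inj _ _ _ p1 p2.
have inj13 := nonconsecutive_partition_inj _ _ _ p1 p3.
have inj23 := nonconsecutive_partition_inj _ _ _ p2 p3.
(* Pigeonhole: of the three truth values for containing both 0 and 2, two agree. *)
move: inj12 inj13 inj23; do 3 case: (_ && _); by auto.
Qed.
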